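(* For every fixed positive integer $r$, as $n\to\infty$, \[ \log s(n,r) \ge \frac{1}{n-r+1}\binom{n}{r}\log\Bigl(\mathrm{e}^{1-r}(n-r+1)(1+o(1))\Bigr). \]
   Context: $s(n,r)$ denotes the number of sparse paving matroids of rank $r$ on the ground set $[n]=\{1,\dots,n\}$; a matroid of rank $r$ is sparse paving if every $r$-subset of the ground set is either a basis or a circuit-hyperplane. $\log$ is the logarithm to base $2$, $\mathrm{e}$ is Euler's number, and $o(1)$ denotes a quantity tending to $0$ as $n\to\infty$ (for fixed $r$). No divisibility conditions on $n$ and $r$ are assumed. *)

(* Defs.v *)
From mathcomp Require Import all_boot.
From Stdlib Require Import Reals.

Set Implicit Arguments.
Unset Strict Implicit.
Unset Printing Implicit Defensive.

Section Matroids.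
Variable T : finType.
Implicit Types (Bs : {set {set T}}) (X : {set T}).

Definition basis_exchange Bs : bool :=
  [forall B1 in Bs, forall B2 in Bs, forall x in B1 :\: B2,
     exists y in B2 :\: B1, (y |: (B1 :\ x)) \in Bs].

Definition is_matroid Bs : bool := (Bs != set0) && basis_exchange Bs.

Definition mrank Bs X : nat := \max_(B in Bs) #|X :&: B|.

Definition indep Bs X : bool := [exists B in Bs, X \subset B].

Definition circuit Bs X : bool :=
  ~~ indep Bs X && [forall x in X, indep Bs (X :\ x)].

Definition flat Bs X : bool :=
  [forall x in ~: X, mrank Bs X < mrank Bs (x |: X)].

Definition hyperplane Bs X : bool :=
  flat Bs X && (mrank Bs X == (mrank Bs setT).-1).

Definition circuit_hyperplane Bs X : bool := circuit Bs X && hyperplane Bs X.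

Definition matroid_of_rank Bs (r : nat) : bool :=
  is_matroid Bs && [forall B in Bs, #|B| == r].

Definition sparse_paving Bs (r : nat) : bool :=
  [forall X : {set T}, (#|X| == r) ==> ((X \in Bs) || circuit_hyperplane Bs X)].

End Matroids.

Definition s (n r : nat) : nat :=
  #|[set Bs : {set {set 'I_n}} | matroid_of_rank Bs r && sparse_paving Bs r]|.

Definition log2 (x : R) : R := (ln x / ln 2)%R.

(* Main.v *)
Require Import Defs.
From Stdlib Require Import Reals.
From mathcomp Require Import all_boot.

(* The complement, inside the r-subsets, of a family of r-subsets no two of
   which share an (r-1)-subset is a sparse paving matroid, so it suffices to
   count matchings of the linear hypergraph whose vertices are the
   N = C(n, r-1) subsets of size r-1 and whose edges are the r-subsets, each
   seen as the set of its r facets; every vertex has degree D = n-r+1.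

   Matchings are counted by greedy choice.  After i choices a fraction
   q = 1 - ri/N of the vertices is free, and as long as every free vertex v has
   about D q^(r-1) available edges there are about (N/r) D q^r choices for the
   next edge.  Regularity is monitored by an exponential potential
     sum_v exp(lam (d(v)/(D q^(r-1)) - 1 - tol)) + exp(lam (1 - d(v)/(D q^(r-1)) - tol))
   in which the tolerance tol grows like a large power of 1/q, fast enough to
   make the potential a supermartingale under a uniformly random choice; then
   (1 - potential) * prod (number of choices) bounds the number of ordered
   continuations from below, by induction.  The process is run until q = 1/t,
   t a small power of D, and dividing by the factorial of the number of steps
   gives (e^(1-r) D (1+o(1)))^(N/r). *)

Set Implicit Arguments.
Unset Strict Implicit.
Unset Printing Implicit Defensive.

(** * Sparse paving matroids from packings *)

Definition facets {T : finType} (X : {set T}) : {set {set T}} :=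
  [set X :\ x | x in X].

Section SparsePavingComplement.
Variables (T : finType) (r : nat) (C : {set {set T}}).
Hypothesis r_gt0 : 0 < r.
Hypothesis r_lt : r < #|T|.
Hypothesis C_uniform : forall X, X \in C -> #|X| = r.
Hypothesis C_packing :
  forall X Y, X \in C -> Y \in C -> X != Y -> [disjoint facets X & facets Y].

Let Bs := [set X : {set T} | #|X| == r] :\: C.

Lemma card_swap (X : {set T}) a b :
  a \in X -> b \notin X -> #|b |: (X :\ a)| = #|X|.
Proof.
move=> aX bX; rewrite cardsU1 !inE (negPf bX) andbF /= [in RHS](cardsD1 a X) aX.
by [].
Qed.

(** The swapped set shares the facet [X :\ a] with [X], which a packing forbids. *)
Lemma swap_notin_packing (X : {set T}) a b :
  X \in C -> a \in X -> b \notin X -> b |: (X :\ a) \notin C.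
Proof.
move=> XC aX bX; apply/negP => YC.
have XY : X != b |: (X :\ a).
  by apply: contraNneq bX => ->; rewrite !inE eqxx.
have /pred0P /(_ (X :\ a)) /= := C_packing XC YC XY.
case/andP; split; first exact: imset_f.
apply/imsetP; exists b; first by rewrite !inE eqxx.
apply/setP=> x; rewrite !inE.
by case: (eqVneq x b) => [->|]; rewrite ?(negPf bX) ?andbF.
Qed.

Lemma swap_basis (X : {set T}) a b :
  X \in C -> a \in X -> b \notin X -> b |: (X :\ a) \in Bs.
Proof.
move=> XC aX bX; rewrite in_setD swap_notin_packing // inE card_swap //.
by rewrite C_uniform ?eqxx.
Qed.

Lemma packing_outside (X : {set T}) : X \in C -> exists b, b \notin X.
Proof.
move=> XC; have /set0Pn[b] : ~: X != set0.
  by rewrite -card_gt0 cardsCs setCK C_uniform // subn_gt0.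
by rewrite inE; exists b.
Qed.

Lemma basis_card B : B \in Bs -> #|B| = r.
Proof. by rewrite !inE => /andP[_ /eqP]. Qed.

Lemma complement_neq0 : Bs != set0.
Proof.
have [X /eqP Xr] : exists X : {set T}, #|X| == r.
  have : 0 < #|[set X : {set T} | #|X| == r]|.
    by rewrite card_draws bin_gt0 ltnW.
  by case/card_gt0P => X; rewrite inE => ?; exists X.
case: (boolP (X \in C)) => XC; last first.
  by apply/set0Pn; exists X; rewrite !inE XC Xr eqxx.
have [b bX] := packing_outside XC.
have /card_gt0P[a aX] : 0 < #|X| by rewrite Xr.
by apply/set0Pn; exists (b |: (X :\ a)); apply: swap_basis.
Qed.

(** The candidates [z |: (B1 :\ x)] share the facet [B1 :\ x], so at most one of them lies in [C].
    Exchange could fail only if that one were the sole candidate, but then it would be [B2] itself,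
    which is not in [C]. *)
Lemma complement_exchange : basis_exchange Bs.
Proof.
apply/forall_inP => B1 B1s; apply/forall_inP => B2 B2s.
apply/forall_inP => x /setDP [xB1 xB2].
have cB : #|B1 :\: B2| = #|B2 :\: B1|.
  by rewrite !cardsD (basis_card B1s) (basis_card B2s) setIC.
have /card_gt0P[y yB] : 0 < #|B2 :\: B1|.
  by rewrite -cB; apply/card_gt0P; exists x; rewrite inE xB1 xB2.
have swap z : z \in B2 :\: B1 -> z |: (B1 :\ x) \notin C ->
    [exists y0 in B2 :\: B1, y0 |: B1 :\ x \in Bs].
  move=> zB zC; apply/exists_inP; exists z => //.
  case/setDP: (zB) => _ zB1.
  by rewrite in_setD zC inE card_swap ?basis_card ?eqxx.
case: (boolP (y |: (B1 :\ x) \in C)) => yC; last exact: swap yB yC.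
case: (boolP [exists z in B2 :\: B1, z != y]) => [/exists_inP[z zB zy]|].
  apply: (swap z zB).
  have -> : z |: (B1 :\ x) = z |: ((y |: (B1 :\ x)) :\ y).
    case/setDP: yB => _ yB1; apply/setP=> t; rewrite !inE.
    by case: (eqVneq t y) => [->|] //=; rewrite (negPf yB1) andbF.
  apply: swap_notin_packing yC _ _; rewrite !inE ?eqxx // (negPf zy) /=.
  by case/setDP: zB => _ /negPf ->; rewrite andbF.
move=> /exists_inPn H.
have D2 : B2 :\: B1 = [set y].
  apply/eqP; rewrite eqEsubset sub1set yB andbT; apply/subsetP => z zB.
  by rewrite inE -[_ == _]negbK; apply: H.
have D1 : B1 :\: B2 = [set x].
  apply/esym/eqP; rewrite eqEcard sub1set inE xB1 xB2 /= cB D2 !cards1 //.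
case/setDP: (B2s) => _ /negP[]; move: yC; congr (_ \in C).
apply/setP=> t; move/setP/(_ t): D1; move/setP/(_ t): D2; rewrite !inE.
by case: (t \in B1); case: (t \in B2); case: (t == x); case: (t == y).
Qed.

Lemma mrank_le (X : {set T}) k :
  (forall B, B \in Bs -> #|X :&: B| <= k) -> mrank Bs X <= k.
Proof. by move=> H; apply/bigmax_leqP. Qed.

Lemma mrank_ge (X : {set T}) B : B \in Bs -> #|X :&: B| <= mrank Bs X.
Proof. by move=> BB; apply: (bigmax_sup B). Qed.

(** A basis has size [r] and differs from [X], so it meets [X] in at most [r.-1] elements; a
    one-element swap attains this. *)
Lemma mrank_packing (X : {set T}) : X \in C -> mrank Bs X = r.-1.
Proof.
move=> XC; apply/eqP; rewrite eqn_leq; apply/andP; split.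
  apply: mrank_le => B BB; rewrite -ltnS prednK //.
  rewrite ltn_neqAle -{2}(C_uniform XC) subset_leq_card ?subsetIl // andbT.
  apply/negP => /eqP cr.
  have XI : X :&: B = X by apply/eqP; rewrite eqEcard subsetIl cr C_uniform /=.
  have XB : X = B.
    by apply/eqP; rewrite eqEcard (basis_card BB) (C_uniform XC) leqnn andbT -XI subsetIr.
  by move: BB; rewrite -XB inE XC.
have [b bX] := packing_outside XC.
have /card_gt0P[a aX] : 0 < #|X| by rewrite C_uniform.
apply: leq_trans (mrank_ge X (swap_basis XC aX bX)).
have <- : #|X :\ a| = r.-1 by move: (cardsD1 a X); rewrite aX C_uniform // => ->.
apply/subset_leq_card/subsetP => x; rewrite !inE => /andP[-> ->].
by rewrite orbT.
Qed.

Lemma mrank_setT : mrank Bs setT = r.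
Proof.
apply/eqP; rewrite eqn_leq mrank_le => [|B BB]; last by rewrite setTI basis_card.
have /set0Pn[B BB] := complement_neq0.
by rewrite -{1}(basis_card BB) -[X in #|pred_of_set X|]setTI mrank_ge.
Qed.

(** The only r-set containing [X] is [X], hence dependence; the other properties follow because
    every one-element swap out of [X] is a basis. *)
Lemma packing_circuit_hyperplane (X : {set T}) :
  X \in C -> circuit_hyperplane Bs X.
Proof.
move=> XC; have [b bX] := packing_outside XC.
apply/andP; split; apply/andP; split.
- apply/exists_inP => -[B BB XB]; have XeB : X = B.
    by apply/eqP; rewrite eqEcard XB (basis_card BB) (C_uniform XC) /=.
  by move: BB; rewrite -XeB inE XC.
- apply/forall_inP => x xX; apply/exists_inP.
  by exists (b |: (X :\ x)); [exact: swap_basis | exact: subsetUr].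
- apply/forall_inP => x; rewrite inE => xX.
  rewrite mrank_packing // prednK //.
  have /card_gt0P[a aX] : 0 < #|X| by rewrite C_uniform.
  have BB := swap_basis XC aX xX.
  rewrite -{1}(basis_card BB); apply: leq_trans (mrank_ge (x |: X) BB).
  apply/subset_leq_card/subsetP => y; rewrite !inE.
  by case: (y == x) => //= /andP[-> ->].
- by rewrite mrank_packing // mrank_setT.
Qed.

Lemma complement_sparse_paving :
  matroid_of_rank Bs r && sparse_paving Bs r.
Proof.
rewrite /matroid_of_rank /is_matroid complement_neq0 complement_exchange /=.
apply/andP; split; first by apply/forall_inP => B /basis_card ->.
apply/forallP => X; apply/implyP => Xr; rewrite in_setD inE Xr andbT.
by case: (boolP (X \in C)) => //= /packing_circuit_hyperplane.
Qed.

End SparsePavingComplement.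

(** * Matchings in linear uniform hypergraphs *)

Section Hypergraph.
Variables (V T : finType) (inc : T -> {set V}) (E : {set T}).
Implicit Types (U : {set V}) (e f g : T) (v w : V).

(** [U] stands for the vertices not yet covered by the chosen edges. *)
Definition avail U : {set T} := [set e in E | inc e \subset U].

Definition deg U v : nat := #|[set e in avail U | v \in inc e]|.

(* The number of available edges at [v] that are lost when [e] is chosen. *)
Definition hit U v e : nat :=
  #|[set f in avail U | (v \in inc f) && ~~ [disjoint inc f & inc e]]|.

Definition matchings U k : {set {set T}} :=
  [set M : {set T} | [&& M \subset avail U, #|M| == k &
     [forall e in M, forall f in M, (e != f) ==> [disjoint inc e & inc f]]]].

Lemma matchings0 U : #|matchings U 0| = 1.
Proof.
rewrite (_ : matchings U 0 = [set set0]) ?cards1 //.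
apply/setP => M; rewrite !inE cards_eq0.
case: (eqVneq M set0) => [->|]; rewrite ?andbF // sub0set /=.
by apply/forall_inP => e; rewrite inE.
Qed.

Lemma avail_setD U e :
  avail (U :\: inc e) = [set f in avail U | [disjoint inc f & inc e]].
Proof. by apply/setP => f; rewrite !inE subsetD andbA. Qed.

Lemma deg_setD U v e : deg (U :\: inc e) v + hit U v e = deg U v.
Proof.
rewrite /deg /hit avail_setD.
rewrite -(cardsID [set f | [disjoint inc f & inc e]]
                  [set f in avail U | v \in inc f]).
congr (_ + _); apply: eq_card => f; rewrite !inE.
  by case: (f \in E); case: (inc f \subset U); case: (v \in inc f);
     case: [disjoint _ & _].
by case: (f \in E); case: (inc f \subset U); case: (v \in inc f);
   case: [disjoint _ & _].
Qed.

Variable r : nat.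
Hypothesis inc_card : forall e, e \in E -> #|inc e| = r.

Lemma avail_inc_card U e : e \in avail U -> #|inc e| = r.
Proof. by rewrite inE => /andP[/inc_card]. Qed.

Lemma card_avail U : r * #|avail U| = \sum_(v in U) deg U v.
Proof.
transitivity (\sum_(e in avail U) \sum_(v in U) (v \in inc e : nat)).
  rewrite mulnC -sum_nat_const; apply: eq_bigr => e eA.
  rewrite -(avail_inc_card eA) -sum1_card -big_mkcondr /=.
  move: eA; rewrite inE => /andP[_ /subsetP eU].
  by apply: eq_bigl => v; case: (boolP (v \in inc e)) => [/eU ->|]; rewrite ?andbF.
rewrite exchange_big /=; apply: eq_bigr => v vU.
rewrite /deg -sum1_card -big_mkcondr /=.
by apply: eq_bigl => e; rewrite inE.
Qed.

Hypothesis r_gt0 : 0 < r.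

(** Adding [e] to a matching that avoids its vertices gives one more edge, and each larger matching
    arises at most once for each of its [k.+1] edges. *)
Lemma matchings_step U k :
  \sum_(e in avail U) #|matchings (U :\: inc e) k| <= k.+1 * #|matchings U k.+1|.
Proof.
(* A nonempty edge is not disjoint from itself; here [r_gt0] enters. *)
have notin e (M : {set T}) : e \in avail U -> M \in matchings (U :\: inc e) k ->
    e \notin M.
  move=> eA; rewrite inE avail_setD => /and3P[/subsetP MA _ _].
  apply/negP => /MA; rewrite inE => /andP[_].
  by rewrite -setI_eq0 setIid -cards_eq0 (avail_inc_card eA) eqn0Ngt r_gt0.
have step e : e \in avail U -> #|matchings (U :\: inc e) k| <=
    #|[set M in matchings U k.+1 | e \in M]|.
  move=> eA; rewrite -(card_in_imset (f := fun M => e |: M)); last first.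
    move=> M M' MM MM' /setP eq; apply/setP => f.
    move: (notin _ _ eA MM) (notin _ _ eA MM') (eq f); rewrite !inE.
    by case: (eqVneq f e) => [->|] //= /negPf -> /negPf ->.
  apply/subset_leq_card/subsetP => _ /imsetP[M MM ->].
  have eM := notin _ _ eA MM; move: MM.
  rewrite inE avail_setD => /and3P[/subsetP MA /eqP Mk /forall_inP Md].
  rewrite !inE eqxx /= andbT; apply/and3P; split.
  - apply/subsetP => f; rewrite in_setU1 => /predU1P[->//|/MA].
    by rewrite inE => /andP[].
  - by rewrite cardsU1 eM Mk.
  - have disj f : f \in M -> [disjoint inc f & inc e].
      by move/MA; rewrite inE => /andP[].
    apply/forall_inP => f; rewrite in_setU1 => /predU1P[->|fM];
    apply/forall_inP => g; rewrite in_setU1 => /predU1P[->|gM].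
    + by rewrite eqxx.
    + by rewrite disjoint_sym disj ?implybT.
    + by rewrite disj ?implybT.
    + exact: (forall_inP (Md _ fM)).
apply: leq_trans (_ : \sum_(e in avail U) #|[set M in matchings U k.+1 | e \in M]| <= _).
  exact: leq_sum step.
under eq_bigr => e _ do rewrite -sum1_card.
under eq_bigr => e _.
  under eq_bigl => M do rewrite inE.
  rewrite big_mkcondr /=.
  over.
rewrite exchange_big /= mulnC -sum_nat_const leq_sum // => M.
rewrite inE => /and3P[_ /eqP <- _].
rewrite -big_mkcondr /= sum1_card.
by apply/subset_leq_card/subsetP => e; rewrite unfold_in => /andP[_].
Qed.

Hypothesis inc_linear :
  forall e f, e \in E -> f \in E -> e != f -> #|inc e :&: inc f| <= 1.

Lemma linear_eq e f v w : e \in E -> f \in E -> v != w ->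
  v \in inc e -> w \in inc e -> v \in inc f -> w \in inc f -> e = f.
Proof.
move=> eE fE vw ve we vf wf; apply/eqP/negPn/negP => ef.
have := inc_linear eE fE ef; rewrite leqNgt => /negP[].
have <- : #|[set v; w]| = 2 by rewrite cards2 vw.
by apply/subset_leq_card/subsetP => x /set2P[] ->; rewrite inE ?ve ?vf ?we.
Qed.

Lemma avail_E U e : e \in avail U -> e \in E.
Proof. by rewrite inE => /andP[]. Qed.

(** A lost edge at [v] meets [inc e] in some [w] other than [v], and by linearity [v] and [w]
    determine it. *)
Lemma hit_le U v e : e \in E -> v \notin inc e -> hit U v e <= r.
Proof.
move=> eE ve; rewrite -(inc_card eE) /hit.
pose S w := [set f in avail U | (v \in inc f) && (w \in inc f)].
have S1 w : w \in inc e -> #|S w| <= 1.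
  move=> we; apply/card_le1_eqP => f g; rewrite !inE.
  move=> /andP[/andP[fE _] /andP[vf wf]] /andP[/andP[gE _] /andP[vg wg]].
  by apply/esym; apply: (linear_eq fE gE _ vf wf vg wg); apply: contraNneq ve => ->.
rewrite -[leqRHS]sum1_card; apply: (@leq_trans (\sum_(w in inc e) #|S w|)); last exact: leq_sum S1.
apply: leq_trans (_ : #|\bigcup_(w in inc e) S w| <= _).
  apply/subset_leq_card/subsetP => f; rewrite !inE => /and3P[fA vf].
  case/pred0Pn => w /= /andP[wf we].
  by apply/bigcupP; exists w; rewrite // !inE fA vf wf.
elim/big_rec2: _ => [|w n B we le]; first by rewrite cards0.
by apply: leq_trans (leq_card_setU _ _) _; rewrite leq_add2l.
Qed.

(* Linearity makes the double count exact: an edge [e] other than [g] that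
   misses [v] meets [inc g :\ v] in at most one vertex. *)
Lemma sum_hit U v :
  \sum_(e in avail U | v \notin inc e) hit U v e + deg U v * r.-1 =
  \sum_(g in avail U | v \in inc g) \sum_(w in inc g :\ v) deg U w.
Proof.
have -> : \sum_(e in avail U | v \notin inc e) hit U v e =
   \sum_(g in avail U | v \in inc g)
     \sum_(e in avail U | v \notin inc e) (~~ [disjoint inc g & inc e] : nat).
  rewrite exchange_big /=; apply: eq_bigr => e _.
  rewrite /hit -sum1_card -[RHS]big_mkcondr /=.
  by apply: eq_bigl => f; rewrite !inE !andbA.
rewrite /deg -[#|[set e in avail U | v \in inc e]|]sum1_card big_distrl /=.
under [X in _ + X = _]eq_bigl => g do rewrite inE.
rewrite -big_split /=; apply: eq_bigr => g /andP[gA vg].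
have cg : #|inc g :\ v| = r.-1.
  by move: (cardsD1 v (inc g)); rewrite vg (avail_inc_card gA) => ->.
have -> : \sum_(w in inc g :\ v) #|[set e in avail U | w \in inc e]| =
    \sum_(e in avail U) #|(inc g :\ v) :&: inc e|.
  under eq_bigr => w _ do rewrite -sum1_card.
  under eq_bigr => w _.
    under eq_bigl => e do rewrite inE.
    rewrite big_mkcondr /=; over.
  rewrite exchange_big /=; apply: eq_bigr => e _.
  by rewrite -big_mkcondr /= -sum1_card; apply: eq_bigl => w; rewrite !inE.
rewrite mul1n [RHS](bigD1 g) //= addnC; congr (_ + _).
  by rewrite (setIidPl (subD1set _ _)) cg.
rewrite big_mkcondr [RHS]big_mkcondr /=; apply: eq_bigr => e eA.
case: (eqVneq e g) => [->|eg]; first by rewrite vg.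
have lin := inc_linear (avail_E gA) (avail_E eA) _.
rewrite eq_sym eg in lin; have {}lin := lin isT.
case: (boolP (v \in inc e)) => ve /=.
  apply/esym/eqP; rewrite cards_eq0 -subset0; apply/subsetP => w.
  rewrite !inE => /andP[/andP[wv wg] we].
  by case/eqP: eg; apply: (linear_eq (avail_E eA) (avail_E gA) wv).
have -> : (inc g :\ v) :&: inc e = inc g :&: inc e.
  apply/setP => w; rewrite !inE; case: (eqVneq w v) => [->|] //=.
  by rewrite (negPf ve) andbF.
rewrite -setI_eq0 -cards_eq0; move: lin; by case: #|_| => [|[]].
Qed.

End Hypergraph.

(** * The hypergraph of r-subsets and their facets *)

Section Facets.
Variables (T : finType) (k : nat).
Implicit Types X Y P : {set T}.

Definition draws j : {set {set T}} := [set X : {set T} | #|X| == j].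

Lemma in_draws j X : (X \in draws j) = (#|X| == j).
Proof. by rewrite inE. Qed.

Lemma card_facets X : #|facets X| = #|X|.
Proof.
apply: card_in_imset => x y xX yX /setP/(_ x).
by rewrite !inE eqxx xX andbT /=; case: eqVneq.
Qed.

Lemma facets_sub X : X \in draws k.+1 -> facets X \subset draws k.
Proof.
rewrite in_draws => /eqP cX; apply/subsetP => _ /imsetP[x xX ->].
by rewrite in_draws -eqSS -cX (cardsD1 x X) xX.
Qed.

(** Two distinct facets determine the set; this is the source of linearity. *)
Lemma facetsU X P Q : P \in facets X -> Q \in facets X -> P != Q -> X = P :|: Q.
Proof.
case/imsetP=> x xX -> /imsetP[y yX ->] PQ.
have xy : x != y by apply: contraNneq PQ => ->.
apply/setP=> z; rewrite !inE.
case: (eqVneq z x) => [->|_]; first by rewrite xX xy.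
by case: (z \in X); rewrite ?andbF.
Qed.

Lemma facets_linear X Y : X != Y -> #|facets X :&: facets Y| <= 1.
Proof.
move=> XY; apply/card_le1_eqP => P Q; rewrite !inE.
move=> /andP[PX PY] /andP[QX QY]; apply/eqP; apply: contraNT XY => PQ.
by rewrite (facetsU QX PX PQ) -(facetsU QY PY PQ).
Qed.

Lemma avail_draws : avail facets (draws k.+1) (draws k) = draws k.+1.
Proof.
by apply/setP => X; rewrite inE; case: (boolP (X \in _)) => // /facets_sub ->.
Qed.

Lemma deg_draws P : P \in draws k ->
  deg facets (draws k.+1) (draws k) P = #|T| - k.
Proof.
rewrite in_draws => /eqP cP; rewrite /deg avail_draws.
rewrite -cP -(cardC P) addKn.
rewrite -[RHS](card_in_imset (f := fun x => x |: P)); last first.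
  move=> x y; rewrite !inE => xP yP /setP/(_ x).
  by rewrite !inE eqxx (negPf xP) orbF; case: eqVneq.
apply: eq_card => X; rewrite !inE; apply/andP/imsetP.
  case=> /eqP cX /imsetP[x xX PE]; exists x; last by rewrite PE setD1K.
  by rewrite !inE PE !inE eqxx.
case=> x; rewrite inE => xP ->; split; first by rewrite cardsU1 xP cP.
by apply/imsetP; exists x; rewrite ?setU1K // !inE eqxx.
Qed.

End Facets.

(** Complementation inside the r-subsets is injective and turns packings into sparse paving
    matroids. *)
Lemma matchings_le_s n k m : k.+1 < n ->
  #|matchings facets (@draws 'I_n k.+1) (@draws 'I_n k) m| <= s n k.+1.
Proof.
move=> kn; have sub M : M \in matchings facets (@draws 'I_n k.+1) (@draws 'I_n k) m ->
    M \subset @draws 'I_n k.+1.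
  by rewrite inE avail_draws => /and3P[].
rewrite -(card_in_imset (f := fun M => @draws 'I_n k.+1 :\: M)); last first.
  have inv (M : {set {set 'I_n}}) : M \subset @draws 'I_n k.+1 ->
      @draws 'I_n k.+1 :\: (@draws 'I_n k.+1 :\: M) = M.
    by move=> MD; rewrite setDDr setDv set0U (setIidPr MD).
  by move=> M M' /sub MD /sub MD' eqD; rewrite -(inv M) // -(inv M') // eqD.
apply/subset_leq_card/subsetP => _ /imsetP[M MM ->].
rewrite inE; apply: complement_sparse_paving => //; first by rewrite card_ord.
  by move=> X /(subsetP (sub _ MM)); rewrite in_draws => /eqP.
move=> X Y XM YM XY; move: MM; rewrite inE => /and3P[_ _ /forall_inP /(_ X XM)].
by move=> /forall_inP /(_ Y YM) /implyP; apply.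
Qed.

(** Used to see that the degree [D] is at most the number [N] of vertices. *)
Lemma sub_le_bin n k : 0 < k < n -> n - k <= 'C(n, k).
Proof.
case: k => // k /= kn; rewrite -(leq_pmul2l (ltn0Sn k)) mul_bin_left.
apply: leq_trans (leq_mul (leq_sub2l n (leqnSn k)) (_ : k.+1 <= 'C(n, k))).
  by rewrite mulnC.
by rewrite -[X in X <= _](binSn k) leq_bin2l // ltnW.
Qed.

Lemma bin_le_expn n k : 'C(n, k) <= n ^ k.
Proof.
apply: (@leq_trans (n ^_ k)); first by rewrite -bin_ffact leq_pmulr ?fact_gt0.
elim: k => // k IH; rewrite ffactnSr expnSr leq_mul //; exact: leq_subr.
Qed.

From mathcomp Require Import all_order all_algebra.
From mathcomp Require Import ring lra.
From mathcomp Require Import all_classical all_reals all_analysis.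
Import Order.TTheory GRing.Theory Num.Theory.

(** * Real estimates *)

Section Estimates.
Local Open Scope ring_scope.
Variable R : realType.
Implicit Types (h eta x y : R).

(** Squaring [expR (x / 2) * (1 - x / 2) <= 1] reduces this to a polynomial inequality. *)
Lemma expR_le_quadratic x : `|x| <= 1 / 4 -> expR x <= 1 + x + x ^+ 2.
Proof.
rewrite ler_norml => /andP[x1 x2].
have e0 := expR_gt0 (x / 2).
have -> : expR x = expR (x / 2) ^+ 2 by rewrite expr2 -expRD; congr expR; field.
have p : 0 < 1 - x / 2 by lra.
have le : expR (x / 2) * (1 - x / 2) <= 1.
  have := expR_ge1Dx (- (x / 2)); rewrite expRN => le.
  by rewrite -ler_pdivlMl // mulr1; lra.
have sq : (expR (x / 2) * (1 - x / 2)) ^+ 2 <= 1.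
  by rewrite expr_le1 // mulr_ge0 ?ltW.
have q : 1 <= (1 + x + x ^+ 2) * (1 - x / 2) ^+ 2.
  have -> : (1 + x + x ^+ 2) * (1 - x / 2) ^+ 2 =
    1 + x ^+ 2 / 4 * (1 - 3 * x + x ^+ 2) by field.
  by rewrite lerDl mulr_ge0 // ?divr_ge0 ?sqr_ge0 //; nra.
rewrite -(ler_pM2r (exprn_gt0 2 p)); apply: le_trans q.
by rewrite -exprMn.
Qed.

(** One step of the supermartingale: [a] is the deterministic change of an exponent, [b * L i] the
    random one. The quadratic bound together with [L i ^ 2 <= rho * L i] leaves
    [expR a * (1 - a) * A], which is at most [A]. *)
Lemma sum_expR_le (I : finType) (P : pred I) (L : I -> R) (A a b rho : R) :
  0 <= rho -> (forall i, P i -> 0 <= L i <= rho) -> `|b| * rho <= 1 / 4 ->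
  #|P|%:R <= A -> (b + b ^+ 2 * rho) * (\sum_(i | P i) L i) <= - a * A ->
  \sum_(i | P i) expR (a + b * L i) <= A.
Proof.
move=> rho0 HL brho PA H.
have A0 : 0 <= A by apply: le_trans PA.
apply: (@le_trans _ _ (\sum_(i | P i) expR a * (1 + (b + b ^+ 2 * rho) * L i))).
  apply: ler_sum => i Pi; rewrite expRD ler_pM2l ?expR_gt0 //.
  have /andP[L0 L1] := HL i Pi.
  apply: le_trans (expR_le_quadratic _) _.
    by rewrite normrM (ger0_norm L0); apply: le_trans brho; rewrite ler_wpM2l.
  have : b ^+ 2 * (L i * L i) <= b ^+ 2 * (rho * L i).
    by rewrite ler_wpM2l ?sqr_ge0 // ler_wpM2r.
  by rewrite exprMn; nra.
rewrite -mulr_sumr big_split /= -mulr_sumr sumr_const.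
apply: (@le_trans _ _ (expR a * (A * (1 - a)))).
  rewrite ler_pM2l ?expR_gt0 // -[X in X + _]/(#|P|%:R); lra.
apply: (@le_trans _ _ (expR a * (A * expR (- a)))).
  rewrite ler_pM2l ?expR_gt0 // ler_wpM2l //; exact: expR_ge1Dx.
by rewrite mulrCA -expRD subrr expR0 mulr1.
Qed.

Lemma inv_pow_ge h k : 0 <= h < 1 -> 1 + k%:R * h <= ((1 - h) ^+ k)^-1.
Proof.
case/andP=> h0 h1; have p : 0 < (1 - h) ^+ k by rewrite exprn_gt0 // subr_gt0.
rewrite -(ler_pM2r p) mulVf ?gt_eqF //.
elim: k {p} => [|k IH]; first by rewrite mul0r addr0 mul1r expr0.
apply: le_trans IH; rewrite exprS mulrA ler_wpM2r //.
  by rewrite exprn_ge0 // subr_ge0 ltW.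
have : 0 <= (k%:R + 1) * h ^+ 2 by rewrite mulr_ge0 ?sqr_ge0 ?addr_ge0.
by rewrite -natr1; lra.
Qed.

Lemma inv_pow_le h k : 0 <= h -> 2 * k%:R * h <= 1 -> h < 1 ->
  ((1 - h) ^+ k)^-1 <= 1 + k%:R * h + 2 * k%:R ^+ 2 * h ^+ 2.
Proof.
move=> h0 kh h1; have p : 0 < (1 - h) ^+ k by rewrite exprn_gt0 // subr_gt0.
have bern : 1 - k%:R * h <= (1 - h) ^+ k.
  elim: k {kh p} => [|k IH]; first by rewrite mul0r subr0 expr0.
  have Kh2 : 0 <= k%:R * h ^+ 2 by rewrite mulr_ge0 ?sqr_ge0.
  rewrite exprS -natr1.
  have : (1 - h) * (1 - k%:R * h) <= (1 - h) * (1 - h) ^+ k.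
    by rewrite ler_wpM2l // subr_ge0 ltW.
  by lra.
rewrite -(ler_pM2r p) mulVf ?gt_eqF //.
have : (1 + k%:R * h + 2 * k%:R ^+ 2 * h ^+ 2) * (1 - k%:R * h) <=
       (1 + k%:R * h + 2 * k%:R ^+ 2 * h ^+ 2) * (1 - h) ^+ k.
  by rewrite ler_wpM2l // !addr_ge0 // ?mulr_ge0 ?sqr_ge0.
apply: le_trans.
have -> : (1 + k%:R * h + 2 * k%:R ^+ 2 * h ^+ 2) * (1 - k%:R * h) =
  1 + (k%:R * h) ^+ 2 * (1 - 2 * k%:R * h) by ring.
by rewrite lerDl mulr_ge0 ?sqr_ge0 // subr_ge0.
Qed.

(* One greedy step seen from one free vertex: [Dd] is the typical degree, [y] the
   degree divided by [Dd], [h] the fraction of free vertices used by an edge,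
   [eta] and [eta'] the tolerance before and after the step, [kap] the factor by
   which the typical degree drops, [A] the number of available edges and [S] the
   sum over these of the degree lost at the vertex. *)
Section Drift.
Variables (K c h eta eta' Dd kap A y S lam beta : R).
Hypothesis K0 : 0 <= K.
Hypothesis h_gt0 : 0 < h.
Hypothesis eta_gt0 : 0 < eta.
Hypothesis eta_le : eta <= 1 / 4.
Hypothesis Dd_gt0 : 0 < Dd.
Hypothesis eta_Dd : 1 <= eta * Dd.
Hypothesis h_eta : 2 * (K + 1) ^+ 2 * h <= eta.
Hypothesis kap_ge : 1 + K * h <= kap.
Hypothesis kap_le : kap <= 1 + K * h + 2 * K ^+ 2 * h ^+ 2.
Hypothesis cK : 16 * (K + 1) <= c.
Hypothesis eta'_ge : eta * (1 + c * h) <= eta'.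
Hypothesis A_ge : Dd * (1 - eta) <= A * h.
Hypothesis A_le : A * h <= Dd * (1 + eta).
Hypothesis y0 : 0 <= y.
Hypothesis y1 : y <= 1 + eta.
Hypothesis lam_gt0 : 0 < lam.
Hypothesis lam_le : 2 * lam * (K + 1) <= eta * Dd.

Hypothesis betaE : beta = lam * kap / Dd.

Let Kh1 : 0 <= K * h. Proof. by rewrite mulr_ge0 // ltW. Qed.
Let KKh : 0 <= K ^+ 2 * h. Proof. by rewrite mulr_ge0 ?sqr_ge0 // ltW. Qed.
Let Kh : 2 * K ^+ 2 * h <= eta.
Proof. by move: Kh1 KKh h_eta h_gt0; lra. Qed.
Let kap1 : 1 <= kap. Proof. by move: kap_ge Kh1; lra. Qed.

Lemma kap_le_eta : kap <= 1 + eta.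
Proof.
move: K0 h_gt0 eta_gt0 eta_le Dd_gt0 eta_Dd h_eta kap_ge kap_le cK eta'_ge.
move: A_ge A_le y0 y1 lam_gt0 lam_le Kh1 KKh Kh kap1.
move=> F0 F1 F2 F3 F4 F5 F6 F7 F8 F9 F10 F11 F12 F13 F14 F15 F16 F17 F18 F19 F20.
apply: le_trans kap_le _.
have h1 : h <= 1 by lra.
have : K ^+ 2 * h * h <= K ^+ 2 * h by rewrite ler_piMr.
by lra.
Qed.

(** [K + 1] will bound the degree lost in one step, so the quadratic term of [sum_expR_le] is a
    relative correction of at most [eta]. *)
Lemma beta_le : beta * (K + 1) <= eta.
Proof.
move: K0 h_gt0 eta_gt0 eta_le Dd_gt0 eta_Dd h_eta kap_ge kap_le cK eta'_ge.
move: A_ge A_le y0 y1 lam_gt0 lam_le Kh1 KKh Kh kap1.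
move=> F0 F1 F2 F3 F4 F5 F6 F7 F8 F9 F10 F11 F12 F13 F14 F15 F16 F17 F18 F19 F20.
rewrite betaE mulrAC ler_pdivrMr //; apply: le_trans lam_le.
rewrite ler_pM2r; last by lra.
by rewrite [2 * lam]mulrC ler_pM2l //; have := kap_le_eta; lra.
Qed.

Let beta_ge0 : 0 <= beta.
Proof. by rewrite betaE divr_ge0 ?mulr_ge0 ?ltW // (lt_le_trans ltr01). Qed.

(** The drop of the typical degree raises [y] by [(kap - 1) * y], about [K * h * y], and the average
    degree loss lowers it by about as much. What survives is of order [eta * h] and is absorbed by
    [eta' - eta >= c * eta * h]. *)
Lemma up_drift : y * Dd * K * (Dd * (1 - eta) - 1) <= S ->
  (- beta + (- beta) ^+ 2 * (K + 1)) * S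
    <= - (lam * ((kap - 1) * y - (eta' - eta))) * A.
Proof.
move: K0 h_gt0 eta_gt0 eta_le Dd_gt0 eta_Dd h_eta kap_ge kap_le cK eta'_ge.
move: A_ge A_le y0 y1 lam_gt0 lam_le Kh1 KKh Kh kap1.
move=> F0 F1 F2 F3 F4 F5 F6 F7 F8 F9 F10 F11 F12 F13 F14 F15 F16 F17 F18 F19 F20.
move=> HS.
have S1 : y * K * Dd * Dd * (1 - 2 * eta) <= S.
  apply: le_trans HS.
  have : y * K * Dd * 1 <= y * K * Dd * (eta * Dd).
    by rewrite ler_wpM2l // !mulr_ge0 //; lra.
  by lra.
have S0 : 0 <= S.
  by apply: le_trans S1; rewrite !mulr_ge0 //; lra.
have main : ((kap - 1) * y - (eta' - eta)) * (A * h) <=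
             kap * (1 - eta) * h * (S / Dd).
  have R0 : y * K * Dd * (1 - 3 * eta) * h <= kap * (1 - eta) * h * (S / Dd).
    apply: (@le_trans _ _ (1 * (1 - eta) * h * (y * K * Dd * (1 - 2 * eta)))).
      have : 0 <= h * (y * K * Dd) * eta ^+ 2.
        by rewrite !mulr_ge0 ?sqr_ge0 //; lra.
      by nra.
    apply: ler_pM.
    - by rewrite !mulr_ge0 //; lra.
    - by rewrite !mulr_ge0 //; lra.
    - by rewrite ler_pM2r // ler_wpM2r //; lra.
    - rewrite ler_pdivlMr //; lra.
  apply: le_trans R0.
  (* Only a positive left factor calls for the upper bound on [A * h]. *)
  case: (lerP ((kap - 1) * y - (eta' - eta)) 0) => [neg|pos].
    apply: (@le_trans _ _ 0).
      by rewrite mulr_le0_ge0 //; apply: le_trans A_ge; rewrite mulr_ge0 //; lra.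
    by rewrite !mulr_ge0 //; lra.
  apply: (@le_trans _ _ (((kap - 1) * y - (eta' - eta)) * (Dd * (1 + eta)))).
    by rewrite ler_pM2l.
  have f1 : (kap - 1) * y - (eta' - eta) <= h * (y * (K + eta) - c * eta).
    have : (kap - 1) * y <= (K * h + eta * h) * y.
      rewrite ler_wpM2r //; have := kap_le.
      have : 2 * K ^+ 2 * h * h <= eta * h by rewrite ler_wpM2r //; lra.
      by nra.
    have := eta'_ge; nra.
  apply: (@le_trans _ _ (h * (y * (K + eta) - c * eta) * (Dd * (1 + eta)))).
    by rewrite ler_wpM2r // mulr_ge0 //; lra.
  have f2 : (y * (K + eta) - c * eta) * (1 + eta) <= y * K * (1 - 3 * eta).
    have : 4 * y * K + y * (1 + eta) <= c * (1 + eta) by nra.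
    have := eta_gt0; nra.
  have : 0 < h * Dd by rewrite mulr_gt0.
  by nra.
have b1 : kap * (1 - eta) * h * (S / Dd) * lam <= beta * (1 - beta * (K + 1)) * S * h.
  have -> : kap * (1 - eta) * h * (S / Dd) * lam = (beta * S * h) * (1 - eta).
    by rewrite betaE; field; rewrite gt_eqF.
  have := beta_le; have : 0 <= beta * S * h by rewrite !mulr_ge0 //; lra.
  by nra.
rewrite -(ler_pM2r h_gt0).
have : ((kap - 1) * y - (eta' - eta)) * (A * h) * lam <=
    kap * (1 - eta) * h * (S / Dd) * lam by rewrite ler_wpM2r //; lra.
by rewrite sqrrN expr2; nra.
Qed.

(** The same cancellation with the signs reversed, so an upper bound on [S] is what matters. *)
Lemma low_drift : 0 <= S -> S <= y * Dd * K * (Dd * (1 + eta)) ->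
  (beta + beta ^+ 2 * (K + 1)) * S
    <= - (lam * (- ((kap - 1) * y) - (eta' - eta))) * A.
Proof.
move: K0 h_gt0 eta_gt0 eta_le Dd_gt0 eta_Dd h_eta kap_ge kap_le cK eta'_ge.
move: A_ge A_le y0 y1 lam_gt0 lam_le Kh1 KKh Kh kap1.
move=> F0 F1 F2 F3 F4 F5 F6 F7 F8 F9 F10 F11 F12 F13 F14 F15 F16 F17 F18 F19 F20.
move=> S0 HS.
have main : kap * (1 + eta) * h * (S / Dd) <=
   ((kap - 1) * y + (eta' - eta)) * (A * h).
  apply: (@le_trans _ _ ((1 + eta) * (1 + eta) * h * (y * K * Dd * (1 + eta)))).
    apply: ler_pM.
    - by rewrite !mulr_ge0 //; lra.
    - by rewrite divr_ge0 //; lra.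
    - rewrite ler_pM2r // ler_wpM2r ?kap_le_eta //; lra.
    - rewrite ler_pdivrMr //; apply: le_trans HS _; lra.
  apply: (@le_trans _ _ (h * (K * y + c * eta) * (Dd * (1 - eta)))).
    have f : (1 + eta) ^+ 3 * (y * K) <= (K * y + c * eta) * (1 - eta).
      have e3 : (1 + eta) ^+ 3 <= 1 + 4 * eta by nra.
      apply: (@le_trans _ _ ((1 + 4 * eta) * (y * K))).
        by rewrite ler_wpM2r // mulr_ge0.
      have yK : y * K <= 5 / 4 * K by rewrite ler_wpM2r //; lra.
      have : 5 * (y * K) * eta <= (c * (1 - eta)) * eta.
        rewrite ler_pM2r //; nra.
      by lra.
    have : 0 < h * Dd by rewrite mulr_gt0.
    by nra.
  apply: ler_pM.
  - by rewrite mulr_ge0 //; [lra | rewrite addr_ge0 // mulr_ge0 //; lra].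
  - by rewrite mulr_ge0 //; lra.
  - have : K * h * y <= (kap - 1) * y by rewrite ler_wpM2r //; move: kap_ge; lra.
    by have := eta'_ge; lra.
  - exact: A_ge.
have b1 : beta * (1 + beta * (K + 1)) * S * h <= kap * (1 + eta) * h * (S / Dd) * lam.
  have -> : kap * (1 + eta) * h * (S / Dd) * lam = (beta * S * h) * (1 + eta).
    by rewrite betaE; field; rewrite gt_eqF.
  have := beta_le; have : 0 <= beta * S * h by rewrite !mulr_ge0 //; lra.
  by nra.
rewrite -(ler_pM2r h_gt0).
have : kap * (1 + eta) * h * (S / Dd) * lam <=
  ((kap - 1) * y + (eta' - eta)) * (A * h) * lam by rewrite ler_wpM2r //; lra.
by rewrite expr2; nra.
Qed.

End Drift.
End Estimates.

(** * Integral bounds for sums of logarithms *)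

Section Stirling.
Local Open Scope ring_scope.
Variable R : realType.
Implicit Types x y t : R.

Lemma ln_le_sub1 x : 0 < x -> ln x <= x - 1.
Proof.
move=> x0; have e : 1 + (x - 1) = x by lra.
by rewrite -[in X in X <= _]e le_ln1Dx //; lra.
Qed.

Lemma ln_ge_1BV x : 0 < x -> 1 - x^-1 <= ln x.
Proof.
move=> x0; have := @ln_le_sub1 x^-1; rewrite invr_gt0 => /(_ x0).
by rewrite lnV ?posrE //; lra.
Qed.

(** The right-hand side is the integral of [ln] from [1] to [m + 1]. *)
Lemma ln_fact_le m : ln (m`!%:R : R) <= m.+1%:R * ln m.+1%:R - m%:R.
Proof.
elim: m => [|m IH]; first by rewrite fact0 ln1 mulr0 subr0.
rewrite factS natrM lnM ?posrE ?ltr0n ?fact_gt0 //.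
have m1 : 0 < m.+1%:R :> R by rewrite ltr0n.
have m2 : 0 < m.+2%:R :> R by rewrite ltr0n.
have := @ln_ge_1BV (m.+2%:R / m.+1%:R) (divr_gt0 m2 m1).
rewrite ln_div ?posrE // invf_div -(ler_pM2l m2).
have -> : m.+2%:R * (1 - m.+1%:R / m.+2%:R) = 1 :> R.
  by rewrite mulrBr mulr1 mulrC divfK ?gt_eqF // -natrB // subSnn.
have -> : m.+2%:R = m.+1%:R + 1 :> R by rewrite natr1.
have e : m%:R = m.+1%:R - 1 :> R by rewrite -natr1 addrK.
by rewrite e in IH; lra.
Qed.

(** The left-hand side is the integral of [ln] from [x - m] to [x], and the sum is its upper Riemann
    sum. *)
Lemma sum_ln_ge x m : m%:R < x ->
  x * ln x - x - ((x - m%:R) * ln (x - m%:R) - (x - m%:R))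
    <= \sum_(i < m) ln (x - i%:R).
Proof.
elim: m => [|m IH] mx; first by rewrite big_ord0 subr0 subrr.
rewrite big_ord_recr /=; move: mx; rewrite -natr1 => mx.
have {}IH := IH (lt_trans _ mx).
have p : 0 < x - m%:R - 1 by lra.
have q : 0 < x - m%:R by lra.
have := @ln_le_sub1 ((x - m%:R) / (x - m%:R - 1)) (divr_gt0 q p).
rewrite ln_div ?posrE // -(ler_pM2l p).
have -> : (x - m%:R - 1) * ((x - m%:R) / (x - m%:R - 1) - 1) = 1.
  by field; rewrite gt_eqF.
have -> : x - (m%:R + 1) = x - m%:R - 1 by ring.
move=> H; have {}IH : x * ln x - x -
  ((x - m%:R) * ln (x - m%:R) - (x - m%:R)) <= \sum_(i < m) ln (x - i%:R).
  by apply: IH; rewrite ltrDl.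
lra.
Qed.

End Stirling.

(** * The potential *)

Section Potential.
Local Open Scope ring_scope.
Variable R : realType.
Variables (V T : finType) (inc : T -> {set V}) (E : {set T}) (k c : nat).
Variables (D N eta0 lam : R).
Hypothesis inc_card : forall e, e \in E -> #|inc e| = k.+1.
Hypothesis inc_linear : forall e f,
  e \in E -> f \in E -> e != f -> (#|inc e :&: inc f| <= 1)%N.
Hypothesis c_ge : (16 * k.+1 <= c)%N.
Hypothesis D_gt0 : 0 < D.
Hypothesis N_gt0 : 0 < N.
Hypothesis eta0_gt0 : 0 < eta0.
Hypothesis lam_gt0 : 0 < lam.
Implicit Types (U : {set V}) (v w : V) (e f g : T) (u d : R).

(** Heuristically, each of the [k] other vertices of an edge is still free with probability
    [u / N]. *)
Definition expdeg u : R := D * (u / N) ^+ k.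
Definition tol u : R := eta0 * (N / u) ^+ c.
Definition pot u d : R :=
  expR (lam * (d / expdeg u - 1 - tol u)) + expR (lam * (1 - d / expdeg u - tol u)).
Definition potential U : R := \sum_(v in U) pot #|U|%:R (deg inc E U v)%:R.

(** The side conditions of the drift estimates for [h = k.+1 / u], [eta = tol u] and
    [Dd = expdeg u]. *)
Definition controlled u : Prop :=
  [/\ 0 < u, tol u <= 1 / 4, 1 <= tol u * expdeg u,
      2 * k.+1%:R ^+ 2 * (k.+1%:R / u) <= tol u
    & 2 * lam * k.+1%:R <= tol u * expdeg u].

Lemma expdeg_gt0 u : 0 < u -> 0 < expdeg u.
Proof. by move=> u0; rewrite mulr_gt0 // exprn_gt0 // divr_gt0. Qed.

Lemma tol_gt0 u : 0 < u -> 0 < tol u.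
Proof. by move=> u0; rewrite mulr_gt0 // exprn_gt0 // divr_gt0. Qed.

Lemma pot_ge0 u d : 0 <= pot u d.
Proof. by rewrite addr_ge0 // expR_ge0. Qed.

Lemma potential_ge0 U : 0 <= potential U.
Proof. by apply: sumr_ge0 => v _; exact: pot_ge0. Qed.

Lemma pot_lt1 u d : 0 < u -> pot u d < 1 ->
  expdeg u * (1 - tol u) <= d <= expdeg u * (1 + tol u).
Proof.
move=> u0 p1; have Dd := expdeg_gt0 u0.
have up : expR (lam * (d / expdeg u - 1 - tol u)) < 1.
  by apply: le_lt_trans p1; rewrite lerDl expR_ge0.
have lo : expR (lam * (1 - d / expdeg u - tol u)) < 1.
  by apply: le_lt_trans p1; rewrite lerDr expR_ge0.
rewrite expR_lt1 pmulr_rlt0 // in up.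
rewrite expR_lt1 pmulr_rlt0 // in lo.
rewrite ![expdeg u * _]mulrC; apply/andP; split.
  by rewrite -ler_pdivlMr //; lra.
by rewrite -ler_pdivrMr //; lra.
Qed.

Lemma deg_bounds U v : (0 < #|U|)%N -> potential U < 1 -> v \in U ->
  expdeg #|U|%:R * (1 - tol #|U|%:R) <= (deg inc E U v)%:R
    <= expdeg #|U|%:R * (1 + tol #|U|%:R).
Proof.
move=> U0 p1 vU; apply: pot_lt1; first by rewrite ltr0n.
apply: le_lt_trans p1; rewrite /potential (bigD1 v) //= lerDl.
by apply: sumr_ge0 => w _; exact: pot_ge0.
Qed.

Section Step.
Variable U : {set V}.
Hypothesis U_controlled : controlled #|U|%:R.
Hypothesis U_small : potential U < 1.

Let u : R := #|U|%:R.
Let A : R := #|avail inc E U|%:R.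
Let r : R := k.+1%:R.
Let h := r / u.
Let u0 : 0 < u. Proof. by case: U_controlled. Qed.
Let U0 : (0 < #|U|)%N. Proof. by move: u0; rewrite ltr0n. Qed.
Let h0 : 0 < h. Proof. by rewrite divr_gt0 // ltr0n. Qed.

(** Averages the degree bounds over the free vertices by means of [card_avail]. *)
Lemma avail_bounds :
  expdeg u * (1 - tol u) <= A * h /\ A * h <= expdeg u * (1 + tol u).
Proof.
have rA : r * A = \sum_(v in U) (deg inc E U v)%:R.
  by rewrite -natrM (card_avail inc_card) natr_sum.
have -> : A * h = (r * A) / u by rewrite /h; field; rewrite gt_eqF.
have cU (x : R) : x * u = \sum_(v in U) x by rewrite sumr_const mulr_natr.
rewrite rA ler_pdivlMr // ler_pdivrMr // !cU.
by split; apply: ler_sum => v vU; case/andP: (deg_bounds U0 U_small vU).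
Qed.

Let S v : R := \sum_(e in avail inc E U | v \notin inc e) (hit inc E U v e)%:R.

(** [sum_hit] expresses [S v] through the degrees of the [k] other vertices on each edge at [v]; its
    correction term becomes the [- 1] of the lower bound. *)
Lemma sum_hit_bounds v : v \in U ->
  [/\ 0 <= S v,
      (deg inc E U v)%:R * k%:R * (expdeg u * (1 - tol u) - 1) <= S v
    & S v <= (deg inc E U v)%:R * k%:R * (expdeg u * (1 + tol u))].
Proof.
move=> vU; set d := deg inc E U v.
have S0 : 0 <= S v by apply: sumr_ge0.
have SE : S v + d%:R * k%:R =
   \sum_(g in avail inc E U | v \in inc g) \sum_(w in inc g :\ v) (deg inc E U w)%:R.
  rewrite /S -natr_sum -natrM -natrD.
  rewrite -[k]/(k.+1.-1) (sum_hit inc_card inc_linear) // natr_sum.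
  by apply: eq_bigr => g _; rewrite natr_sum.
have cst (x : R) : d%:R * k%:R * x =
   \sum_(g in avail inc E U | v \in inc g) \sum_(w in inc g :\ v) x.
  rewrite -mulrA /d /deg -sum1_card natr_sum mulr_suml.
  apply: eq_big => [g|g]; first by rewrite inE.
  rewrite inE => /andP[gA vg]; rewrite sumr_const mul1r mulr_natl; congr (_ *+ _).
  by move: (cardsD1 v (inc g)); rewrite vg (avail_inc_card inc_card gA) => -[].
have gU g w : g \in avail inc E U -> w \in inc g :\ v -> w \in U.
  by rewrite !inE => /andP[_ /fintype.subsetP gU] /andP[_ /gU].
split=> //.
- rewrite mulrBr mulr1 lerBlDr SE cst.
  apply: ler_sum => g /andP[gA _]; apply: ler_sum => w wg.
  by case/andP: (deg_bounds U0 U_small (gU _ _ gA wg)).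
- apply: (@le_trans _ _ (S v + d%:R * k%:R)); first by rewrite lerDl mulr_ge0.
  rewrite SE cst.
  apply: ler_sum => g /andP[gA _]; apply: ler_sum => w wg.
  by case/andP: (deg_bounds U0 U_small (gU _ _ gA wg)).
Qed.

Lemma h_le : 2 * r ^+ 2 * h <= 1 / 4.
Proof. by case: U_controlled => _ t1 _ t2 _; exact: le_trans t2 t1. Qed.

(** Choosing [e] changes each exponent by a deterministic part and by [beta] times the degree lost,
    up to sign, so [sum_expR_le] and the drift lemmas apply. Edges through [v] are left out because
    they remove [v] from [U]. *)
Lemma vertex_step v : v \in U ->
  \sum_(e in avail inc E U | v \notin inc e)
      pot (u - r) (deg inc E (U :\: inc e) v)%:R <= A * pot u (deg inc E U v)%:R.
Proof.
move=> vU; case: U_controlled; rewrite -/u => _ t1 t2 t3 t4.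
have [A1 A2] := avail_bounds.
have [S0 S1 S2] := sum_hit_bounds vU.
have /andP[d1 d2] := deg_bounds U0 U_small vU.
rewrite -/u in d1 d2.
set d : R := (deg inc E U v)%:R in d1 d2 S1 S2 *.
have K0 : 0 <= k%:R :> R by [].
have r1 : 1 <= r by rewrite ler1n.
have rE : r = k%:R + 1 by rewrite natr1.
have hl := h_le.
have rh : r ^+ 2 * h >= r * h.
  by rewrite ler_pM2r // expr2 ler_peMr // (le_trans ler01).
have hr : r * h >= h by rewrite ler_peMl // ltW.
have h1 : h < 1 by lra.
have kh1 : 2 * k%:R * h <= 1 by move: hl rh hr h0; rewrite rE; lra.
have Dd0 := expdeg_gt0 u0.
have tu0 := tol_gt0 u0.
have uh : u - r = u * (1 - h).
  by rewrite /h; field; rewrite gt_eqF.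
pose kap := ((1 - h) ^+ k)^-1.
have kap1 : 1 + k%:R * h <= kap by apply: inv_pow_ge; rewrite ltW.
have kap2 : kap <= 1 + k%:R * h + 2 * k%:R ^+ 2 * h ^+ 2.
  by apply: inv_pow_le; rewrite // ltW.
have Dd' : expdeg (u - r) = expdeg u / kap.
  by rewrite /expdeg /kap invrK uh -[RHS]mulrA -exprMn; congr (_ * _ ^+ _); rewrite mulrAC.
have eta' : tol u * (1 + c%:R * h) <= tol (u - r).
  rewrite /tol uh invfM [N * (_ * _)]mulrA [(N / u / _) ^+ c]exprMn.
  rewrite [leRHS]mulrA ler_pM2l // exprVn.
  by apply: inv_pow_ge; rewrite ltW.
have kap0 : 0 < kap by rewrite (lt_le_trans ltr01) // (le_trans _ kap1) // lerDl mulr_ge0 // ltW.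
pose beta := lam * kap / expdeg u.
have cK : 16 * (k%:R + 1) <= c%:R :> R by rewrite natr1 -natrM ler_nat.
have h3 : 2 * (k%:R + 1) ^+ 2 * h <= tol u by rewrite -rE.
rewrite -[k.+1%:R]/r rE in t4.
have y0 : 0 <= d / expdeg u by rewrite divr_ge0 // ltW.
have y1 : d / expdeg u <= 1 + tol u by rewrite ler_pdivrMr // mulrC.
have dE : d = d / expdeg u * expdeg u by rewrite divfK ?gt_eqF.
rewrite dE in S1 S2.
have b0 : 0 <= beta by rewrite ltW // divr_gt0 // mulr_gt0.
have bl := beta_le K0 h0 tu0 t1 Dd0 t2 h3 kap1 kap2 cK eta' A1 A2 y0 y1 lam_gt0 t4
             (erefl beta).
have up := up_drift K0 h0 tu0 t1 Dd0 t2 h3 kap1 kap2 cK eta' A1 A2 y0 y1 lam_gt0 t4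
             (erefl beta) S1.
have lo := low_drift K0 h0 tu0 t1 Dd0 t2 h3 kap1 kap2 cK eta' A1 A2 y0 y1 lam_gt0 t4
             (erefl beta) S0 S2.
have dL e : (deg inc E (U :\: inc e) v)%:R = d - (hit inc E U v e)%:R.
  by rewrite /d -(deg_setD inc E U v e) natrD addrK.
have Lr e : (e \in avail inc E U) && (v \notin inc e) ->
    0 <= ((hit inc E U v e)%:R : R) <= k%:R + 1.
  case/andP=> eA ve; rewrite ler0n natr1 ler_nat.
  exact: (hit_le inc_card inc_linear U (avail_E eA) ve).
have cardP : #|[pred e | (e \in avail inc E U) && (v \notin inc e)]|%:R <= A.
  rewrite ler_nat; apply/subset_leq_card/fintype.subsetP => e.
  by rewrite inE => /andP[].
have r0 : 0 <= k%:R + 1 :> R by rewrite -rE ler0n.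
have bb : `|beta| * (k%:R + 1) <= 1 / 4 by rewrite ger0_norm //; apply: le_trans t1.
have bb' : `|- beta| * (k%:R + 1) <= 1 / 4 by rewrite normrN.
have sup := sum_expR_le r0 Lr bb' cardP up.
have slo := sum_expR_le r0 Lr bb cardP lo.
rewrite /pot big_split /= mulrDr; apply: lerD.
- apply: le_trans (_ : expR (lam * (d / expdeg u - 1 - tol u)) * A <= _);
    last by rewrite mulrC.
  apply: le_trans (ler_wpM2l (expR_ge0 _) sup).
  rewrite mulr_sumr; apply: ler_sum => e _.
  rewrite -expRD ler_expR dL Dd' /beta le_eqVlt; apply/orP; left; apply/eqP.
  by field; rewrite !gt_eqF.
- apply: le_trans (_ : expR (lam * (1 - d / expdeg u - tol u)) * A <= _);
    last by rewrite mulrC.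
  apply: le_trans (ler_wpM2l (expR_ge0 _) slo).
  rewrite mulr_sumr; apply: ler_sum => e _.
  rewrite -expRD ler_expR dL Dd' /beta le_eqVlt; apply/orP; left; apply/eqP.
  by field; rewrite !gt_eqF.
Qed.

Lemma card_setD_avail e : e \in avail inc E U -> #|U :\: inc e|%:R = u - r.
Proof.
move=> eA; have eU : inc e \subset U by move: eA; rewrite inE => /andP[].
rewrite -natrB; last by rewrite -(avail_inc_card inc_card eA) subset_leq_card.
by rewrite cardsD (finset.setIidPr eU) (avail_inc_card inc_card eA).
Qed.

(** The potential does not grow on average over a uniformly random available edge; exchanging the
    sums reduces this to single vertices. *)
Lemma potential_step :
  \sum_(e in avail inc E U) potential (U :\: inc e) <= A * potential U.
Proof.
rewrite /potential mulr_sumr.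
apply: (@le_trans _ _ (\sum_(v in U) \sum_(e in avail inc E U | v \notin inc e)
      pot (u - r) (deg inc E (U :\: inc e) v)%:R)); last first.
  by apply: ler_sum => v vU; exact: vertex_step.
rewrite le_eqVlt; apply/orP; left; apply/eqP.
under eq_bigr => e eA do rewrite card_setD_avail //.
under [RHS]eq_bigr => v _ do rewrite big_mkcondr /=.
rewrite [RHS]exchange_big /=; apply: eq_bigr => e _.
by rewrite -big_mkcondr /=; apply: eq_bigl => v; rewrite inE andbC.
Qed.

End Step.

(** The number of available edges that [avail_bounds] guarantees when [u] vertices are free. *)
Definition choices u : R := u * expdeg u * (1 - tol u) / k.+1%:R.

Lemma choices_ge0 u : controlled u -> 0 <= choices u.
Proof.
case=> u0 t1 _ _ _; have Dd0 := expdeg_gt0 u0.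
by rewrite divr_ge0 // mulr_ge0 //; [exact: ltW (mulr_gt0 u0 Dd0) | lra].
Qed.

(* When the potential is at least [1] the bound is vacuous, so the choices that
   spoil the regularity of the free vertices never have to be excluded. *)
Lemma matchings_lower_bound m U :
  (forall i, (i < m)%N -> controlled (#|U|%:R - k.+1%:R * i%:R)) ->
  (1 - potential U) * \prod_(i < m) choices (#|U|%:R - k.+1%:R * i%:R)
    <= (m`! * #|matchings inc E U m|)%:R.
Proof.
elim: m U => [|m IH] U good.
  by rewrite big_ord0 mulr1 matchings0 muln1 lerBlDr lerDl potential_ge0.
have prod0 : 0 <= \prod_(i < m.+1) choices (#|U|%:R - k.+1%:R * i%:R).
  by apply: prodr_ge0 => i _; apply/choices_ge0/good.
case: (lerP 1 (potential U)) => [big|small].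
  by apply: le_trans (ler0n _ _); rewrite mulr_le0_ge0 // subr_le0.
have good0 : controlled #|U|%:R by have := good 0 (ltn0Sn m); rewrite mulr0 subr0.
set A : R := #|avail inc E U|%:R.
set P := \prod_(i < m) choices (#|U|%:R - k.+1%:R * i.+1%:R).
have P0 : 0 <= P.
  by apply: prodr_ge0 => i _; apply/choices_ge0/(good i.+1); rewrite ltnS.
apply: (@le_trans _ _ (\sum_(e in avail inc E U) (m`! * #|matchings inc E (U :\: inc e) m|)%:R)).
  (* By [potential_step] the weights [1 - potential] sum to at least [A * (1 - potential U)], and
     [A] is at least the first factor of the product. *)
  apply: (@le_trans _ _ (\sum_(e in avail inc E U) (1 - potential (U :\: inc e)) * P)).
    have sumE : \sum_(e in avail inc E U) (1 - potential (U :\: inc e)) =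
        A - \sum_(e in avail inc E U) potential (U :\: inc e).
      by rewrite big_split /= sumrN sumr_const.
    rewrite -mulr_suml sumE big_ord_recl mulr0 subr0 mulrA ler_wpM2r //.
    have := potential_step good0 small.
    have [+ _] := avail_bounds good0 small.
    rewrite -/A; case: good0 => u0 t1 _ _ _ A1 st.
    apply: (@le_trans _ _ ((1 - potential U) * A)); last first.
      by rewrite mulrBl mul1r mulrC; lra.
    rewrite ler_wpM2l ?subr_ge0 ?(ltW small) //.
    rewrite /choices ler_pdivrMr ?ltr0n // -mulrA mulrC -ler_pdivlMr //.
    by rewrite -mulrA.
  apply: ler_sum => e eA.
  have cU := card_setD_avail eA.
  have shift i : #|U :\: inc e|%:R - k.+1%:R * i%:R = #|U|%:R - k.+1%:R * i.+1%:R :> R.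
    by rewrite cU -[i.+1%:R]natr1; ring.
  have := IH (U :\: inc e).
  under eq_bigr => i _ do rewrite shift.
  by apply=> i im; rewrite shift; apply: good.
rewrite -natr_sum ler_nat -big_distrr /= factS [(m.+1 * _)%N]mulnC -mulnA leq_mul2l.
by rewrite (matchings_step (r := k.+1)) ?orbT.
Qed.

End Potential.

(** * Choice of parameters *)

Section GreedyRange.
Local Open Scope ring_scope.
Variable R : realType.
Variables (k c : nat) (t N : R).

(** For [N / t <= u <= N] these exponents give [t^-(c+1) <= tol u <= 1/t] and
    [expdeg u >= t^(2c+3)], so [tol u * expdeg u >= t^(c+2)], which dictates [lam]. Still
    [lam * eta0] is of order [t], which makes the initial potential small. *)
Let D := t ^+ (k + 2 * c.+1).+1.
Let eta0 := t^-1 ^+ c.+1.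
Let lam := t ^+ c.+2 / (2 * k.+1%:R).
Let M0 := N / k.+1%:R.

Hypothesis t_ge4 : 4 <= t.
Hypothesis t_ge : 2 * k.+1%:R ^+ 3 <= t.
Hypothesis D_le : D <= N.

Let t0 : 0 < t. Proof. exact: lt_le_trans t_ge4. Qed.
Let D0 : 0 < D. Proof. exact: exprn_gt0. Qed.
Let N0 : 0 < N. Proof. exact: lt_le_trans D_le. Qed.
Let r0 : 0 < k.+1%:R :> R. Proof. by rewrite ltr0n. Qed.

Lemma tol_range u : N / t <= u <= N ->
  0 < u /\ eta0 <= tol c N eta0 u <= t^-1.
Proof.
case/andP=> u1 u2; have u0 : 0 < u by apply: lt_le_trans u1; rewrite divr_gt0.
have e0 : 0 < eta0 by rewrite exprn_gt0 // invr_gt0.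
split=> //; rewrite /tol; apply/andP; split.
  by rewrite ler_peMr ?(ltW e0) // exprn_ege1 // ler_pdivlMr // mul1r.
apply: (@le_trans _ _ (eta0 * t ^+ c)).
  rewrite ler_pM2l // lerXn2r ?nnegrE ?divr_ge0 ?(ltW u0) ?(ltW N0) ?(ltW t0) //.
  by rewrite ler_pdivrMr // mulrC -ler_pdivrMr.
by rewrite /eta0 exprSr exprVn mulrAC mulVf ?mul1r // expf_neq0 ?gt_eqF.
Qed.

Lemma controlled_range u : N / t <= u <= N -> controlled k c D N eta0 lam u.
Proof.
move=> ur; have [u0 /andP[e1 e2]] := tol_range ur; case/andP: ur => u1 u2.
have e0 : 0 < eta0 by rewrite exprn_gt0 // invr_gt0.
have t4 := t_ge4; have t1 : 1 <= t by lra.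
have ex : t ^+ (2 * c.+1).+1 <= expdeg k D N u.
  rewrite /expdeg /D -addnS exprD -mulrA mulrC -mulrA ler_peMr //.
    by rewrite exprn_ge0 // ltW.
  rewrite -exprMn exprn_ege1 // mulrAC ler_pdivlMr // mul1r.
  by rewrite -ler_pdivrMr.
have te : t ^+ c.+2 <= tol c N eta0 u * expdeg k D N u.
  apply: le_trans (ler_pM _ _ e1 ex); rewrite ?(ltW e0) ?exprn_ge0 ?(ltW t0) //.
  rewrite mul2n -addnn -addnS.
  by rewrite /eta0 exprVn exprD mulrA mulVf ?mul1r // expf_neq0 ?gt_eqF.
split=> //.
- apply: le_trans e2 _; rewrite -[t^-1]mul1r ler_pdivrMr //; lra.
- by apply: le_trans te; rewrite exprn_ege1.
- apply: le_trans e1.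
  have h1 : k.+1%:R / u <= k.+1%:R / (N / t).
    by rewrite ler_pM2l // lef_pV2 ?posrE ?divr_gt0.
  apply: (@le_trans _ _ (2 * k.+1%:R ^+ 2 * (k.+1%:R / (N / t)))).
    by rewrite ler_pM2l // mulr_gt0 // exprn_gt0.
  have -> : 2 * k.+1%:R ^+ 2 * (k.+1%:R / (N / t)) = 2 * k.+1%:R ^+ 3 * t / N.
    by field; rewrite !gt_eqF.
  (* With [r = k.+1] the chain is [2 r^3 t <= t^2 <= eta0 * D <= eta0 * N], as
     [eta0 * D = t^(k+c+2)]. *)
  rewrite ler_pdivrMr //.
  apply: (@le_trans _ _ (t * t)); first by rewrite ler_pM2r.
  apply: (@le_trans _ _ (eta0 * D)); last by rewrite ler_pM2l.
  have -> : D = t ^+ c.+1 * t ^+ (k + c.+2).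
    by rewrite -exprD /D mul2n -addnn addnCA !addnS.
  rewrite /eta0 exprVn mulrA mulVf ?mul1r ?expf_neq0 ?gt_eqF //.
  by rewrite -expr2 ler_weXn2l // !addnS.
- apply: le_trans te; rewrite /lam le_eqVlt; apply/orP; left; apply/eqP.
  by field; rewrite gt_eqF.
Qed.

Lemma choices_range u : N / t <= u <= N ->
  M0 * D * (1 - t^-1) * (u / N) ^+ k.+1 <= choices k c D N eta0 u.
Proof.
move=> ur; have [u0 /andP[e1 e2]] := tol_range ur.
have -> : choices k c D N eta0 u =
    M0 * D * (1 - tol c N eta0 u) * (u / N) ^+ k.+1.
  rewrite /choices /expdeg /M0 exprS; field.
  by rewrite !gt_eqF.
rewrite ler_pM2r ?exprn_gt0 ?divr_gt0 // ler_pM2l ?mulr_gt0 ?divr_gt0 //.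
by rewrite lerB.
Qed.

Lemma lam_eta0 : lam * eta0 = t / (2 * k.+1%:R).
Proof.
rewrite /lam /eta0 [t ^+ _.+2]exprS exprVn; field.
by rewrite expf_neq0 ?gt_eqF.
Qed.

Lemma lam_gt0 : 0 < lam.
Proof. by rewrite divr_gt0 ?exprn_gt0 ?mulr_gt0. Qed.

Lemma eta0_gt0 : 0 < eta0.
Proof. by rewrite exprn_gt0 // invr_gt0. Qed.

(** Here [u / N = 1 - i / M0], and by [sum_ln_ge] the product of these over [i < m] is at least
    [expR (- m)], hence at least [expR (- M0)]. *)
Lemma ln_prod_choices m : m%:R <= (1 - t^-1) * M0 ->
  expR (m%:R * ln (M0 * D * (1 - t^-1)) - k.+1%:R * M0) <=
  \prod_(i < m) choices k c D N eta0 (N - k.+1%:R * i%:R).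
Proof.
move=> mM.
have t4 := t_ge4; have ti0 : 0 < t^-1 by rewrite invr_gt0.
have ti1 : t^-1 <= 1 / 4 by rewrite -[t^-1]mul1r ler_pdivrMr //; lra.
have M00 : 0 < M0 by rewrite divr_gt0.
have tM : 0 < t^-1 * M0 by rewrite mulr_gt0.
have mM' : m%:R < M0 by lra.
pose g i := ln (M0 * D * (1 - t^-1)) + k.+1%:R * (ln (M0 - i%:R) - ln M0).
have c0 : 0 < M0 * D * (1 - t^-1) by rewrite !mulr_gt0 //; lra.
have im (i : 'I_m) : i%:R < M0 by apply: lt_trans mM'; rewrite ltr_nat.
apply: (@le_trans _ _ (expR (\sum_(i < m) g i))).
  have -> : \sum_(i < m) g i = m%:R * ln (M0 * D * (1 - t^-1)) +
      k.+1%:R * (\sum_(i < m) ln (M0 - i%:R) - m%:R * ln M0).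
    rewrite /g big_split /= sumr_const card_ord -mulr_sumr big_split /= sumrN.
    by rewrite sumr_const card_ord !mulr_natl.
  rewrite ler_expR lerD2l -mulrN ler_pM2l //.
  have p0 : 0 < M0 - m%:R by lra.
  have lp : ln (M0 - m%:R) <= ln M0 by rewrite ler_ln ?posrE // gerBl.
  by rewrite -(ler_pM2l p0) in lp; have := sum_ln_ge mM'; lra.
rewrite expR_sum; apply: ler_prod => i _; rewrite expR_ge0 /=.
have ui : N - k.+1%:R * i%:R = k.+1%:R * (M0 - i%:R).
  by rewrite /M0; field; rewrite gt_eqF.
apply: le_trans (choices_range _).
  rewrite expRD lnK ?posrE // ler_pM2l //.
  have -> : (N - k.+1%:R * i%:R) / N = (M0 - i%:R) / M0.
    by rewrite ui /M0; field; rewrite !gt_eqF.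
  rewrite expRM_natl expRB !lnK ?posrE ?subr_gt0 //.
have ii : i.+1%:R <= m%:R :> R by rewrite ler_nat.
apply/andP; split; last by rewrite gerBl mulr_ge0.
have -> : N / t = k.+1%:R * (t^-1 * M0) by rewrite /M0; field; rewrite !gt_eqF.
by rewrite ui ler_pM2l //; move: ii; rewrite -natr1; lra.
Qed.

End GreedyRange.

(** * A lower bound for [s] at finite [n] *)

Section Counting.
Local Open Scope ring_scope.
Variable R : realType.

Lemma ln_s_lower (k c n : nat) (t : R) :
  let D := (n - k)%:R : R in
  let N := 'C(n, k)%:R : R in
  let M0 := N / k.+1%:R in
  (16 * k.+1 <= c)%N -> (k.+1 < n)%N -> 4 <= t -> 2 * k.+1%:R ^+ 3 <= t ->
  t ^+ (k + 2 * c.+1).+1 = D -> D <= N -> t <= M0 ->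
  4 * N <= expR (t / (2 * k.+1%:R)) ->
  M0 * (ln D + 1 - k.+1%:R)
    - (ln 2 + ln M0 + (M0 / t + 1) * (ln D + 1) + 2 * (M0 / t)) <= ln (s n k.+1)%:R.
Proof.
move=> D N M0 c_ge kn t4 tr tD DN tM Nexp.
have t0 : 0 < t by lra.
have D0 : 0 < D by rewrite -tD exprn_gt0.
have N0 : 0 < N by lra.
have r0 : 0 < k.+1%:R :> R by rewrite ltr0n.
have M00 : 0 < M0 by lra.
have ti0 : 0 < t^-1 by rewrite invr_gt0.
have ti1 : t^-1 <= 1 / 4 by rewrite -[t^-1]mul1r ler_pdivrMr //; lra.
pose eta0 := t^-1 ^+ c.+1.
pose lam := t ^+ c.+2 / (2 * k.+1%:R).
(* After [m] steps at least [N / t] vertices are still free. *)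
pose m := Num.truncn ((1 - t^-1) * M0).
have x0 : 0 <= (1 - t^-1) * M0 by rewrite mulr_ge0 // ?(ltW M00) //; lra.
have /andP[m1 m2] := truncn_itv x0; rewrite -/m in m1 m2.
have tM1 : 1 <= t^-1 * M0 by rewrite mulrC ler_pdivlMr // mul1r.
have mM : m.+1%:R <= M0 by rewrite -natr1; lra.
have cU : #|@draws 'I_n k| = 'C(n, k) by rewrite card_draws card_ord.
have DN' : t ^+ (k + 2 * c.+1).+1 <= N by rewrite tD.
have range (i : nat) : (i < m)%N -> N / t <= N - k.+1%:R * i%:R <= N.
  move=> im; have ii : i.+1%:R <= m%:R :> R by rewrite ler_nat.
  apply/andP; split; last by rewrite gerBl mulr_ge0.
  have -> : N / t = k.+1%:R * (t^-1 * M0) by rewrite /M0; field; rewrite !gt_eqF.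
  have -> : N - k.+1%:R * i%:R = k.+1%:R * (M0 - i%:R).
    by rewrite /M0; field; rewrite gt_eqF.
  by rewrite ler_pM2l //; move: ii; rewrite -natr1; lra.
have inc_card (X : {set 'I_n}) : X \in @draws 'I_n k.+1 -> #|facets X| = k.+1.
  by rewrite in_draws card_facets => /eqP.
have bound := @matchings_lower_bound R _ _ _ _ k c D N eta0 lam inc_card
  (fun X Y _ _ => @facets_linear _ X Y) c_ge D0 N0 (eta0_gt0 c t4) (lam_gt0 k c t4)
  m (@draws 'I_n k).
rewrite cU -/N -tD in bound.
have {}bound := bound (fun i im => controlled_range t4 tr DN' (range i im)).
(* Initially every degree is exactly [D], so each of the [N] vertices contributes
   [2 * expR (- (lam * eta0))]. *)
have pot12 : potential facets (@draws 'I_n k.+1) k c (t ^+ (k + 2 * c.+1).+1) N eta0 lam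
    (@draws 'I_n k) <= 1 / 2.
  rewrite /potential cU (eq_bigr (fun=> 2 * expR (- (t / (2 * k.+1%:R))))); last first.
    move=> P Pd; rewrite deg_draws // card_ord tD /pot /expdeg /tol -/N.
    rewrite divff ?gt_eqF // !expr1n !mulr1 divff ?gt_eqF // subrr sub0r mulrN.
    by rewrite (lam_eta0 k c t4); lra.
  rewrite sumr_const cU -[_ *+ _]mulr_natl -/N expRN.
  rewrite mulrA ler_pdivrMr ?expR_gt0 //; lra.
have prodge := ln_prod_choices t4 DN' m1.
rewrite tD -/M0 -/eta0 in prodge.
rewrite tD in bound pot12.
set P := \prod_(i < m) _ in prodge bound.
have half : 1 / 2 * P <= (m`!)%:R * (s n k.+1)%:R.
  apply: (@le_trans _ _ (m`! * #|matchings facets (@draws 'I_n k.+1) (@draws 'I_n k) m|)%:R).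
    apply: le_trans bound; rewrite ler_wpM2r //; last lra.
    exact: le_trans (expR_ge0 _) prodge.
  by rewrite -natrM ler_nat leq_mul2l matchings_le_s ?orbT.
have s0 : 0 < (s n k.+1)%:R :> R.
  have : 0 < (m`!)%:R * (s n k.+1)%:R :> R.
    apply: lt_le_trans half; rewrite mulr_gt0 //.
    exact: lt_le_trans (expR_gt0 _) prodge.
  by rewrite pmulr_rgt0 // ltr0n fact_gt0.
have f0 : 0 < (m`!)%:R :> R by rewrite ltr0n fact_gt0.
have lnle : m%:R * ln (M0 * D * (1 - t^-1)) - k.+1%:R * M0 - ln 2
    <= ln (m`!)%:R + ln (s n k.+1)%:R.
  rewrite -lnM ?posrE // -ler_expR lnK ?posrE ?mulr_gt0 // expRB lnK ?posrE //.
  apply: le_trans half; rewrite mul1r mulrC.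
  by rewrite ler_pM2l // invr_gt0.
have t1 : 0 < 1 - t^-1 by lra.
rewrite (@lnM R (M0 * D)) ?(@lnM R M0 D) ?posrE ?mulr_gt0 // in lnle.
have lnf := @ln_fact_le R m.
have lnm : m.+1%:R * ln m.+1%:R <= m.+1%:R * ln M0.
  by rewrite ler_pM2l ?ltr0n // ler_ln ?posrE ?ltr0n.
have D1 : 0 <= ln D by rewrite ln_ge0 // -tD exprn_ege1 //; lra.
have lnt : - (2 * t^-1) <= ln (1 - t^-1).
  apply: le_trans (ln_ge_1BV t1).
  have -> : 1 - (1 - t^-1)^-1 = - (t^-1 / (1 - t^-1)).
    by field; rewrite subr_eq0 gt_eqF ?gt_eqF //; lra.
  rewrite lerN2 ler_pdivrMr //; nra.
have b1 : - (2 * t^-1) * M0 <= m%:R * ln (1 - t^-1).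
  have : m%:R * (- (2 * t^-1)) <= m%:R * ln (1 - t^-1) by rewrite ler_wpM2l.
  have : m%:R * t^-1 <= M0 * t^-1 by rewrite ler_pM2r //; move: mM; rewrite -natr1; lra.
  lra.
have b2 : ((1 - t^-1) * M0 - 1) * (ln D + 1) <= m%:R * (ln D + 1).
  by rewrite ler_wpM2r //; move: m2; rewrite -?natr1; lra.
(* The term [m * ln M0] cancels against the factorial up to one [ln M0], leaving
   [m * (ln D + 1) - k.+1 * M0] and errors. *)
rewrite -natr1 in lnm lnf.
lra.
Qed.

End Counting.

(** * Size of the error terms *)

Section Asymptotics.
Local Open Scope ring_scope.
Variable R : realType.

(* Chosen so that [expR x >= x ^+ j / j`!] already yields [exp_threshold]. *)
Definition threshold (k c : nat) : nat :=
  let j := ((k + 2 * c.+1).+1 * k).+1 in (4 * 2 ^ k * (2 * k.+1) ^ j * j`!)%N.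

Lemma exp_threshold (k c : nat) (t : R) : (threshold k c)%:R <= t ->
  4 * (2 * t ^+ (k + 2 * c.+1).+1) ^+ k <= expR (t / (2 * k.+1%:R)).
Proof.
rewrite /threshold; set P := (k + 2 * c.+1).+1 => Tt.
set r2 : R := 2 * k.+1%:R; have r20 : 0 < r2 by rewrite mulr_gt0 ?ltr0n.
have t0 : 0 <= t by apply: le_trans Tt.
have x0 : 0 <= t / r2 by rewrite divr_ge0 // ltW.
apply: le_trans (expR_ge1Dxn (P * k) x0).
apply: (@le_trans _ _ ((t / r2) ^+ (P * k).+1 / ((P * k).+1`!)%:R)); last by rewrite lerDr.
have f0 : 0 < ((P * k).+1`!)%:R :> R by rewrite ltr0n fact_gt0.
rewrite ler_pdivlMr // expr_div_n ler_pdivlMr ?exprn_gt0 //.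
rewrite exprMn -exprM [t ^+ _.+1]exprSr.
have := ler_wpM2l (exprn_ge0 (P * k) t0) Tt; apply: le_trans.
rewrite le_eqVlt; apply/orP; left; apply/eqP.
rewrite !natrM !natrX -/r2; rewrite natrM -/r2; ring.
Qed.

Lemma threshold_cube k c : (0 < k)%N -> (2 * k.+1 ^ 3 <= threshold k c)%N.
Proof.
move=> k0; rewrite /threshold; set j := _.+1; rewrite -[X in (X <= _)%N]muln1.
rewrite leq_mul ?fact_gt0 // leq_mul //.
  by rewrite -[X in (X <= _)%N]muln1 leq_mul // expn_gt0.
apply: (@leq_trans ((2 * k.+1) ^ 3)); first by rewrite leq_exp2r // leq_pmull.
rewrite leq_pexp2l // ltnS (leq_trans _ (leq_pmulr _ k0)) //.
by rewrite mulnS addnS ltnS addnS.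
Qed.

Lemma s_lower (k c n : nat) (y : R) :
  let P := (k + 2 * c.+1).+1 in
  let D := (n - k)%:R : R in
  (16 * k.+1 <= c)%N -> (0 < k)%N -> (k.*2.+2 <= n)%N ->
  y ^+ (2 * P) = D -> (threshold k c)%:R <= y ->
  'C(n, k)%:R / k.+1%:R *
    (ln D + 1 - k.+1%:R - (2 * P * k + 4 * P + k + 5)%:R / y) <= ln (s n k.+1)%:R.
Proof.
move=> P D c_ge k0 kn yD Ty.
have kn1 : (k.+1 < n)%N.
  by apply: leq_trans kn; rewrite !ltnS -addnn leq_addr.
have D0 : 0 < D by rewrite ltr0n subn_gt0 ltnW.
have r0 : 0 < k.+1%:R :> R by rewrite ltr0n.
have Tn := threshold_cube c k0.
have T16 : 16 <= (threshold k c)%:R :> R.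
  rewrite ler_nat; apply: leq_trans Tn.
  by rewrite (@leq_mul 2 8) // (@leq_exp2r 2 _ 3).
have y16 : 16 <= y by apply: le_trans Ty.
have y0 : 0 < y by lra.
(* As [t] is a square and [ln D = 2 P ln y <= 2 P y], the error [M0 / t * ln D] is of order
   [M0 / y]. *)
pose t := y ^+ 2.
have yt : y <= t by rewrite /t expr2 ler_peMl //; lra.
have t0 : 0 < t by lra.
have tD : t ^+ P = D by rewrite -exprM.
have tr : 2 * k.+1%:R ^+ 3 <= t.
  by apply: le_trans yt; apply: le_trans Ty; rewrite -natrX -natrM ler_nat.
have DN : D <= 'C(n, k)%:R by rewrite ler_nat sub_le_bin // k0 ltnW.
set N : R := 'C(n, k)%:R in DN *.
set M0 := N / k.+1%:R.
have ND : N <= (2 * D) ^+ k.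
  apply: (@le_trans _ _ (n%:R ^+ k)); first by rewrite -natrX ler_nat bin_le_expn.
  rewrite lerXn2r ?nnegrE ?mulr_ge0 // -natrM ler_nat mulnBr leq_subRL.
    by rewrite !mul2n -[n.*2]addnn leq_add2r (leq_trans _ kn) // leqW.
  by rewrite leq_mul // ltnW // ltnW.
have tM : t <= M0.
  rewrite ler_pdivlMr //; apply: le_trans DN.
  rewrite -tD; have rt : k.+1%:R <= t.
    apply: le_trans tr; rewrite -natrX -natrM ler_nat.
    by apply: (@leq_trans (k.+1 ^ 3)); rewrite ?leq_pmull // -[X in (X <= _)%N]expn1 leq_pexp2l.
  apply: (@le_trans _ _ (t ^+ 2)); first by rewrite expr2 ler_pM2l.
  by rewrite ler_weXn2l //; [lra | rewrite /P mulnS addnS].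
have Nexp : 4 * N <= expR (t / (2 * k.+1%:R)).
  have := @exp_threshold k c t (le_trans Ty yt); rewrite -/P tD; apply: le_trans.
  by rewrite ler_pM2l.
have t4 : 4 <= t by lra.
have := ln_s_lower c_ge kn1 t4 tr tD DN tM Nexp; rewrite -/D -/N -/M0.
apply: le_trans.
have M00 : 0 < M0 by lra.
have lny : ln y <= y by have := ln_le_sub1 y0; lra.
have lnD : ln D = (2 * P)%:R * ln y by rewrite -yD lnXn // mulr_natl.
have PY : ln D <= (2 * P)%:R * y by rewrite lnD ler_wpM2l.
have ln2 : ln (2 : R) <= 1 by have := @ln_le_sub1 R 2 (ltr0n _ 2); lra.
have lnM : ln M0 <= k%:R * (1 + (2 * P)%:R * y).
  have NM : M0 <= (2 * D) ^+ k.
    apply: le_trans ND; rewrite ler_pdivrMr // ler_peMr ?ler1n //; lra.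
  have D2 : 0 < 2 * D by rewrite mulr_gt0.
  apply: (@le_trans _ _ (ln ((2 * D) ^+ k))).
    by rewrite ler_ln ?posrE // exprn_gt0.
  rewrite lnXn // -[ln _ *+ k]mulr_natl ler_wpM2l // (@lnM R 2 D) ?posrE //; lra.
pose q : R := (2 * P)%:R.
have qE (p : nat) : (2 * p * k + 4 * p + k + 5)%:R =
    (2 * p)%:R * k%:R + 2 * (2 * p)%:R + k%:R + 5 :> R.
  by rewrite !natrD !natrM; ring.
rewrite qE -/q in lnM PY *.
have q0 : 0 <= q by [].
have kk0 : 0 <= k%:R :> R by [].
suff : ln 2 + ln M0 + (M0 / t + 1) * (ln D + 1) + 2 * (M0 / t) <=
   M0 * ((q * k%:R + 2 * q + k%:R + 5) / y) by lra.
have Mt : 1 <= M0 / t by rewrite ler_pdivlMr // mul1r.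
have D1 : 0 <= ln D by rewrite ln_ge0 // -tD exprn_ege1 //; lra.
have -> : M0 * ((q * k%:R + 2 * q + k%:R + 5) / y) =
   M0 / t * ((q * k%:R + 2 * q + k%:R + 5) * y).
  by rewrite /t; field; rewrite gt_eqF.
set z := M0 / t in Mt *.
(* The constants [1 + k + 2 + 2] are then multiplied by [y >= 1] to give the numerator
   [q k + 2 q + k + 5]. *)
apply: (@le_trans _ _ (z * (1 + k%:R * (1 + q * y) + 2 * (q * y + 1) + 2))).
  have a1 : 1 + k%:R * (1 + q * y) <= z * (1 + k%:R * (1 + q * y)).
    by rewrite ler_peMl // addr_ge0 // mulr_ge0 // addr_ge0 // mulr_ge0 // ltW.
  have a2 : (z + 1) * (ln D + 1) <= (2 * z) * (q * y + 1).
    by apply: ler_pM; lra.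
  lra.
rewrite ler_pM2l; last lra.
have : k%:R <= k%:R * y by rewrite ler_peMr //; lra.
lra.
Qed.

End Asymptotics.

(** * The asymptotic bound in natural logarithms *)

Section Logarithm.
Local Open Scope ring_scope.
Variable R : realType.

Definition root_of (p : nat) (x : R) : R := expR (ln x / p%:R).

Lemma root_ofX p x : (0 < p)%N -> 0 < x -> root_of p x ^+ p = x.
Proof.
by move=> p0 x0; rewrite -expRM_natr divfK ?pnatr_eq0 -?lt0n // lnK ?posrE.
Qed.

Lemma root_of_ge p (b x : nat) : (0 < p)%N -> (0 < b)%N -> (b ^ p <= x)%N ->
  b%:R <= root_of p x%:R.
Proof.
move=> p0 b0 bx; have x0 : (0 < x)%N by apply: leq_trans bx; rewrite expn_gt0 b0.
have rp : 0 < root_of p x%:R by exact: expR_gt0.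
rewrite -(ler_pXn2r p0) ?nnegrE ?(ltW rp) //.
by rewrite root_ofX ?ltr0n // -natrX ler_nat.
Qed.

(** Rank one is separate: the only vertex is the empty set, so [N = 1] and [D <= N] fails. Each
    singleton alone is a matching. *)
Lemma s1_lower n : (1 < n)%N -> (n <= s n 1)%N.
Proof.
move=> n1; apply: leq_trans (matchings_le_s 1 n1).
have card1 (X : {set 'I_n}) : X \in @draws 'I_n 1 -> #|facets X| = 1%N.
  by rewrite in_draws card_facets => /eqP.
have := matchings_step card1 (ltn0Sn 0) (@draws 'I_n 0) 0.
rewrite mul1n; apply: leq_trans.
rewrite (eq_bigr (fun=> 1%N)) => [|X _]; last by rewrite matchings0.
by rewrite sum1_card avail_draws card_draws card_ord bin1.
Qed.

Lemma ln_s_asymptotics (r : nat) : (0 < r)%N ->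
  exists eps : nat -> R,
    (forall e, 0 < e -> exists N, forall n, (N <= n)%N -> `|eps n| < e) /\
    exists N, forall n, (N <= n)%N ->
      'C(n, r)%:R / (n - r + 1)%:R
        * ln (expR (1 - r%:R) * (n - r + 1)%:R * (1 + eps n)) <= ln (s n r)%:R.
Proof.
case: r => [//|[_|k _]].
  exists (fun=> 0); split.
    by move=> e e0; exists 0%N => n _; rewrite normr0.
  exists 2%N => n n1; rewrite bin1 subnK 1?ltnW //.
  have n0 : 0 < n%:R :> R by rewrite ltr0n ltnW.
  rewrite subrr expR0 addr0 mul1r mulr1 divff ?gt_eqF // mul1r.
  rewrite ler_ln ?posrE ?ler_nat ?s1_lower //.
  by rewrite ltr0n (leq_trans _ (s1_lower n1)) // ltnW.
(* The least exponent that the drift estimates allow; the rank is [k.+2]. *)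
set c := (16 * k.+2)%N; pose P := (k.+1 + 2 * c.+1).+1.
pose C : R := (2 * P * k.+1 + 4 * P + k.+1 + 5)%:R.
pose y n : R := root_of (2 * P) (n - k.+1)%:R.
have y0 n : 0 < y n by exact: expR_gt0.
have C0 : 0 < C by rewrite ltr0n !addnS.
(* Makes [ln (1 + eps n)] exactly [- (C / y n)]. *)
exists (fun n => expR (- (C / y n)) - 1); split.
  move=> e e0; pose b := (Num.truncn (C / e)).+1.
  exists (k.+1 + b ^ (2 * P))%N => n nb.
  have yb : b%:R <= y n.
    by apply: root_of_ge => //; rewrite leq_subRL // (leq_trans _ nb) ?leq_addr.
  rewrite distrC ger0_norm; last by rewrite subr_ge0 expR_le1 oppr_le0 divr_ge0 // ltW.
  have Cy : C / y n < e.
    rewrite ltr_pdivrMr // mulrC -ltr_pdivrMr //.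
    by apply: lt_le_trans yb; exact: truncnS_gt.
  by have := expR_ge1Dx (- (C / y n)); lra.
exists (k.+1 + (threshold k.+1 c) ^ (2 * P) + (k.+1).*2.+2)%N => n Nn.
have kn : (k.+1.*2.+2 <= n)%N by apply: leq_trans Nn; rewrite leq_addl.
have kn2 : (k.+2 < n)%N by apply: leq_trans kn; rewrite doubleS !ltnS leqW // -addnn leq_addr.
have DE : (n - k.+2 + 1 = n - k.+1)%N by rewrite addn1 subnSK // ltnW.
have D0 : 0 < (n - k.+1)%:R :> R by rewrite ltr0n subn_gt0 ltnW.
have T0 : (0 < threshold k.+1 c)%N.
  by apply: leq_trans (threshold_cube c (ltn0Sn k)).
have Ty : (threshold k.+1 c)%:R <= y n.
  apply: root_of_ge => //; rewrite leq_subRL; last by rewrite ltnW // ltnW.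
  by apply: leq_trans Nn; rewrite leq_addr.
have yD : y n ^+ (2 * P) = (n - k.+1)%:R by rewrite root_ofX.
have := @s_lower R k.+1 c n (y n) (leqnn c) (ltn0Sn k) kn yD Ty.
rewrite DE; apply: le_trans.
(* Both sides equal the number of edges a perfect matching would have. *)
have -> : 'C(n, k.+2)%:R / (n - k.+1)%:R = 'C(n, k.+1)%:R / k.+2%:R :> R.
  have Dn : (n - k.+1)%:R != 0 :> R by rewrite gt_eqF.
  apply/eqP; rewrite eqr_div ?Dn ?pnatr_eq0 // -!natrM mulnC mul_bin_left.
  by rewrite mulnC.
rewrite ler_wpM2l ?divr_ge0 // addrCA subrr addr0.
rewrite (@lnM R (_ * _)) ?(@lnM R (expR _)) ?posrE ?mulr_gt0 ?expR_gt0 //.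
by rewrite !expRK -/P -/C; lra.
Qed.

End Logarithm.

(* The bound in logarithms to base two *)
From mathcomp Require Import Rstruct Rstruct_topology.
(* MathComp has rebound the delimiter [R] to [ring_scope]. *)
Delimit Scope R_scope with R.

Theorem theorem2p3 :
  forall r : nat, (0 < r)%N ->
  exists eps : nat -> R, Un_cv eps 0%R /\
  exists N : nat, forall n : nat, (N <= n)%N ->
    (log2 (INR (s n r)) >=
       INR 'C(n, r) / INR (n - r + 1)
       * log2 (exp (1 - INR r) * INR (n - r + 1) * (1 + eps n)))%R.
Proof.
move=> r r0; have [eps [eps0 [N lower]]] := @ln_s_asymptotics R r r0.
exists eps; split.
  move=> e /RltP e0; have [M small] := eps0 e e0.
  by exists M => n /ssrnat.leP Mn; apply/RltP; rewrite /R_dist RabsE RminusE subr0 small.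
exists N => n Nn; apply/Rle_ge/RleP.
rewrite /log2 !RlnE RexpE !INRE !RdivE !RmultE RplusE RminusE mulrA.
by rewrite ler_pM2r ?lower // invr_gt0 ln_gt0 // IZRposE INRE ltr1n.
Qed.
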